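(* Let $\Gamma=\mathrm{IOCG}_n(\mathbf{D},\sigma)$ be an integral oriented circulant graph. Then the following two statements are equivalent: (i) $\Gamma$ has perfect state transfer between vertices $b+n/2$ and $b$, for all $b\in\mathbb{Z}_n$; (ii) $n\in 4\mathbb{N}$ and $\mathbf{D}_2=\{n/4\}$.
   Context: Let $n$ be a positive integer with $n\equiv 0\pmod 4$. For a positive divisor $d$ of $n/4$ and $r\in\{1,3\}$ let $G_n^r(d)=\{dk : k\equiv r \pmod 4,\ \gcd(dk,n)=d\}$, regarded as a subset of $\mathbb{Z}_n$. Given a nonempty set $\mathbf{D}$ of positive divisors of $n/4$ and a map $\sigma:\mathbf{D}\to\{1,-1\}$, put $S_n(d)=G_n^1(d)$ if $\sigma(d)=1$, $S_n(d)=G_n^3(d)$ if $\sigma(d)=-1$, and $\mathcal{C}=\bigcup_{d\in\mathbf{D}}S_n(d)$. Then $\mathrm{IOCG}_n(\mathbf{D},\sigma)$ is the oriented graph with vertex set $\mathbb{Z}_n$ and arc set $\{(a,b): b-a\in\mathcal{C}\}$; the (nonempty) integral oriented circulant graphs, i.e. those whose Hermitian adjacency matrix has only integer eigenvalues, are exactly these graphs. The Hermitian adjacency matrix $H=(h_{uv})$ of an oriented graph has $h_{uv}=\mathrm{i}$ if $(u,v)$ is an arc, $h_{uv}=-\mathrm{i}$ if $(v,u)$ is an arc, and $h_{uv}=0$ otherwise, where $\mathrm{i}=\sqrt{-1}$. Let $U(t)=\exp(\mathrm{i}tH)$ and let $\mathbf{e}_u$ be the standard basis vector indexed by the vertex $u$.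 The graph has perfect state transfer from $u$ to $v$ if there are $t\in\mathbb{R}$ and a complex number $\gamma$ with $|\gamma|=1$ such that $U(t)\mathbf{e}_u=\gamma\mathbf{e}_v$; since $t$ may be any real number this relation is symmetric in $u,v$, and one says perfect state transfer between $u$ and $v$. For a positive integer $x$, $\vartheta_2(x)$ is the exponent of the largest power of $2$ dividing $x$. For $0\le i\le\vartheta_2(n)$, $\mathbf{D}_i=\{d\in\mathbf{D}:\vartheta_2(n/d)=i\}$. *)

(* Defs.v *)
From HB Require Import structures.
From mathcomp Require Import all_boot all_order all_algebra.
From mathcomp Require Import all_classical all_reals all_analysis.
From mathcomp Require Import complex.
Import Order.TTheory GRing.Theory Num.Theory numFieldNormedType.Exports.

Set Implicit Arguments.
Unset Strict Implicit.
Unset Printing Implicit Defensive.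

Local Open Scope classical_set_scope.
Local Open Scope ring_scope.

(* The limit is taken in the normed module of matrices over K.  K is left
   abstract because R[i] carries its topology only as a numFieldType: the balls
   have a positive (hence real) radius in R[i] and are the usual discs. *)
Definition mxexp (K : numFieldType) (m : nat) (A : 'M[K]_m.+1) : 'M[K]_m.+1 :=
  lim (series (fun k : nat => (k`!%:R)^-1 *: A ^+ k) @ \oo).

(* An oriented graph on the vertex set 'I_m is given by its arc relation. *)
Definition hermitian_adjacency (R : realType) (m : nat) (arc : rel 'I_m) :
    'M[R[i]]_m :=
  \matrix_(u, v) (if arc u v then 'i else if arc v u then - 'i else 0).

Definition transition_matrix (R : realType) (m : nat) (arc : rel 'I_m.+1)
    (t : R) : 'M[R[i]]_m.+1 :=
  mxexp (('i * t%:C%C) *: hermitian_adjacency R arc).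

Definition basis_vector (R : realType) (m : nat) (u : 'I_m) : 'cV[R[i]]_m :=
  delta_mx u 0.

Definition perfect_state_transfer (R : realType) (m : nat)
    (arc : rel 'I_m.+1) (u v : 'I_m.+1) : Prop :=
  exists (t : R) (gamma : R[i]), `|gamma| = 1 /\
    transition_matrix arc t *m basis_vector R u = gamma *: basis_vector R v.

(* Here k is any integer, and d * k is reduced modulo n. *)
Definition Gnr (n : nat) (r : int) (d : nat) : set 'Z_n :=
  [set x | exists k : int,
    [/\ (k = r %[mod 4])%Z, gcdz (d%:Z * k) n%:Z = d%:Z & x = (d%:Z * k)%:~R]].
Arguments Gnr : clear implicits.

Definition Sn (n : nat) (sigma : nat -> int) (d : nat) : set 'Z_n :=
  if sigma d == 1 then Gnr n 1 d else Gnr n 3 d.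
Arguments Sn : clear implicits.

Definition connection_set (n : nat) (D : set nat) (sigma : nat -> int) :
    set 'Z_n :=
  \bigcup_(d in D) Sn n sigma d.
Arguments connection_set : clear implicits.

Definition IOCG (n : nat) (D : set nat) (sigma : nat -> int) : rel 'Z_n :=
  fun a b => (b - a) \in connection_set n D sigma.
Arguments IOCG : clear implicits.

Definition Dlevel (n : nat) (D : set nat) (i : nat) : set nat :=
  [set d | D d /\ logn 2 (n %/ d) = i].
Arguments Dlevel : clear implicits.

(* Main.v *)
Require Import Defs.
From mathcomp Require Import all_boot all_order all_algebra.
From mathcomp Require Import all_classical all_reals all_analysis.
From mathcomp Require Import complex.
From mathcomp Require Import zify ring.
Import Order.TTheory GRing.Theory Num.Theory numFieldNormedType.Exports.

Set Implicit Arguments.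
Unset Strict Implicit.
Unset Printing Implicit Defensive.

Local Open Scope classical_set_scope.
Local Open Scope ring_scope.

(** Write n = 4N, w = exp (2 pi i / n), and let chi be the odd Dirichlet
    character modulo 4.  The adjacency matrix H is circulant, hence diagonalised
    by the discrete Fourier transform: the rows (w^(jv))_v are left eigenvectors
    ([dft_eigen]), with eigenvalues 2 f(j) computed below.  In these coordinates
    U(t) acts as multiplication by exp(2it)^f(j), and the translation by n/2 as
    multiplication by (-1)^j.  So transfer between b + n/2 and b at time t with
    phase gamma means exp(2it)^f(j) (-1)^j = gamma for all j
    ([transfer_half_turnP]), and j = 0 forces gamma = 1 because f(0) = 0.

    The eigenvalues.  The entry H_uv is i A(v - u), where A(s), with
    g = gcd(s, n), is chi(s/g) sigma(g) if g is in D and 0 otherwise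
    ([adjacency_entry]).  The condition on gcds makes the Fourier transform of A
    a Ramanujan sum twisted by chi.  It is removed by a triangular
    deconvolution over the divisors of N ([chi4_deconvolution]): there are
    integers k(p), p | N, with A(s) = sum of k(p) chi(ps/N) over the p such that
    N | ps ([signed_indicatorE]).  Each summand has an elementary Gauss sum as
    its transform ([chi4_gauss_sum]), and the result is the integer
    f(j) = sum of p k(p) chi(j/p) over the common divisors p of N and j.

    The equivalence is then a matter of parities.  Let b(q) be the value of A at
    the divisor N/q of n, so that b(q) is sigma(N/q), nonzero and odd, if N/q is
    in D, and 0 otherwise.  Level two consists of the N/q in D with q odd, and
    for odd q the relation b(q) = sum of k(p) chi(p/q) over q | p | N only
    involves odd p.

    If level two is {N}, then b(q) = 0 for all odd q > 1, hence k(q) = 0 for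
    these q and k(1) = b(1) is odd.  So f(j) has the parity of j for all j, and
    t = pi/2 works since exp(2it) = -1.

    Conversely let y = exp(2it), so y^f(j) = -1 for all odd j.  Evaluating
    y^(f(1) f(j)) in two ways shows that f(j) has the parity of f(1).
    Comparing the values of f at the odd divisors of N makes k(q), and hence
    b(q), even for all odd q > 1; thus b(q) = 0, and no N/q other than N lies in
    level two.  Then f(1) = k(1) = b(1), which is nonzero as y^f(1) = -1, so N is
    in D. *)

(** * The character modulo 4 and its deconvolution *)

Definition chi4 (z : int) : int :=
  if (z %% 4)%Z == 1 then 1 else if (z %% 4)%Z == 3 then -1 else 0.

Lemma modz4P (z : int) :
  [\/ (z %% 4)%Z = 0, (z %% 4)%Z = 1, (z %% 4)%Z = 2 | (z %% 4)%Z = 3].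
Proof.
have : (z %% 4)%Z \in [:: 0; 1; 2; 3] by rewrite !inE; lia.
rewrite !inE => /or4P[] /eqP ->; [exact: Or41|exact: Or42|exact: Or43|exact: Or44].
Qed.

Lemma chi4_mod (x y : int) : (x = y %[mod 4])%Z -> chi4 x = chi4 y.
Proof. by rewrite /chi4 => ->. Qed.

Lemma chi4M (x y : int) : chi4 (x * y) = chi4 x * chi4 y.
Proof.
rewrite /chi4 -modzMm.
by case: (modz4P x) => ->; case: (modz4P y) => ->.
Qed.

Lemma chi4N (x : int) : chi4 (- x) = - chi4 x.
Proof. by rewrite -mulN1r chi4M mulN1r. Qed.

Lemma odd_chi4 (x : int) : odd `|chi4 x| = odd `|x|.
Proof.
rewrite /chi4; case: (modz4P x) => e; rewrite e /=; lia.
Qed.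

Lemma chi4_even (k : nat) : ~~ odd k -> chi4 k = 0.
Proof.
rewrite /chi4 => ko.
by have [-> | ->] : (k %% 4)%Z = 0 \/ (k %% 4)%Z = 2 by lia.
Qed.

Lemma odd_abszD (x y : int) : odd `|x + y| = odd `|x| (+) odd `|y|.
Proof. lia. Qed.

Lemma odd_absz_sum (I : Type) (r : seq I) (P : pred I) (F : I -> int) :
  odd `|\sum_(i <- r | P i) F i| = \big[addb/false]_(i <- r | P i) odd `|F i|.
Proof. by apply: (big_morph (fun z : int => odd `|z|) odd_abszD). Qed.

Lemma big_divisorsD1 (R : Type) (idx : R) (op : Monoid.com_law idx) (N p : nat)
    (P : pred nat) (F : nat -> R) : (0 < N)%N -> (p %| N)%N -> P p ->
  \big[op/idx]_(q <- divisors N | P q) F q =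
  op (F p) (\big[op/idx]_(q <- divisors N | P q && (q != p)) F q).
Proof.
move=> N0 pN Pp; rewrite -big_filter (bigD1_seq p) /=; first last.
- by rewrite filter_uniq ?divisors_uniq.
- by rewrite mem_filter Pp -dvdn_divisors.
- by rewrite big_filter_cond.
Qed.

(** The system is triangular for divisibility, with diagonal chi4 1 = 1, so it
    can be solved from the largest divisor of N downwards.  This is Moebius
    inversion twisted by chi4, over the multiples of q. *)
Lemma chi4_deconvolution (N : nat) (b : nat -> int) : (0 < N)%N ->
  exists k : nat -> int, forall q, (q %| N)%N ->
    b q = \sum_(p <- divisors N | (q %| p)%N) k p * chi4 (p %/ q)%N.
Proof.
move=> N0.
(* After m steps the equations are solved for the divisors q > N - m. *)
suff /(_ N) [k kP] : forall m, exists k : nat -> int,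
    forall q, (N < q + m)%N -> (q %| N)%N ->
    b q = \sum_(p <- divisors N | (q %| p)%N) k p * chi4 (p %/ q)%N.
  by exists k => q qN; apply: kP => //; have := dvdn_gt0 N0 qN; lia.
elim=> [|m [k kP]].
  by exists (fun _ => 0) => q Nq /(dvdn_leq N0); lia.
pose q0 := (N - m)%N.
pose k' p := if p == q0 then
  b q0 - \sum_(p <- divisors N | (q0 %| p)%N && (p != q0)) k p * chi4 (p %/ q0)%N
  else k p.
exists k' => q; case: (eqVneq q q0) => [-> _ q0N | qq0 Nq qN].
  have q00 := dvdn_gt0 N0 q0N.
  rewrite (@big_divisorsD1 _ _ _ N q0) //=.
  rewrite {1}/k' eqxx divnn q00 mulr1.
  rewrite [X in _ + X](eq_bigr (fun p => k p * chi4 (p %/ q0)%N)) ?subrK //.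
  by move=> p /andP[_ /negbTE]; rewrite /k' => ->.
have q0q : (q0 < q)%N by move: (dvdn_leq N0 qN) qq0 Nq; rewrite /q0; lia.
rewrite kP //; last by rewrite /q0 in q0q; lia.
rewrite [LHS]big_seq_cond [RHS]big_seq_cond; apply: eq_bigr => p /andP[pN qp].
rewrite /k'; case: eqP => // pq0; move: pN; rewrite -dvdn_divisors // => pN.
by have := dvdn_leq (dvdn_gt0 N0 pN) qp; rewrite pq0 leqNgt q0q.
Qed.

(** * Parity of the half-eigenvalues *)

Section Level.

Variables (N : nat) (N0 : (0 < N)%N) (b k : nat -> int).
Hypothesis bE : forall q, (q %| N)%N ->
  b q = \sum_(p <- divisors N | (q %| p)%N) k p * chi4 (p %/ q)%N.

(** For the k attached to a graph this is half the eigenvalue of H on the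
    character j; chi4 kills the terms in which j %/ p is even. *)
Definition half_eigenvalue (j : nat) : int :=
  \sum_(p <- divisors N | (p %| j)%N) p%:Z * k p * chi4 (j %/ p)%N.
Local Notation f := half_eigenvalue.

(** Among the equations, those with q odd form a subsystem in the unknowns k p
    with p odd, because chi4 kills p %/ q even.  Without the equation q = 1 this
    subsystem is homogeneous and still triangular. *)
Lemma deconvolution_eq0 :
  (forall p, (p %| N)%N -> odd p -> (1 < p)%N -> b p = 0) ->
  forall p, (p %| N)%N -> odd p -> (1 < p)%N -> k p = 0.
Proof.
move=> b0 p; have [m] := ubnP (N - p); elim: m p => // m IH p pm pN po p1.
have p0 : (0 < p)%N by apply: ltnW.
have := bE pN; rewrite b0 // (@big_divisorsD1 _ _ _ N p) //=.
rewrite divnn p0 mulr1 big_seq_cond big1 ?addr0 // => q.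
rewrite -dvdn_divisors // => /and3P[qN pq qp].
have [par|par] := boolP (odd (q %/ p)); last by rewrite chi4_even // mulr0.
have q0 := dvdn_gt0 N0 qN; have := dvdn_leq q0 pq; have := dvdn_leq N0 qN.
move=> le1 le2; have qo : odd q by rewrite -(divnK pq) oddM par.
by rewrite IH ?mul0r //; lia.
Qed.

Lemma weight1E : (forall p, (p %| N)%N -> odd p -> (1 < p)%N -> k p = 0) ->
  b 1%N = k 1%N.
Proof.
move=> k0; rewrite (bE (dvd1n N)) (@big_divisorsD1 _ _ _ N 1) //=.
rewrite mulr1 big_seq_cond big1 ?addr0 // => q.
rewrite -dvdn_divisors // => /and3P[qN _ q1]; rewrite divn1.
have [par|par] := boolP (odd q); last by rewrite chi4_even // mulr0.
by rewrite k0 ?mul0r //; have := dvdn_gt0 N0 qN; lia.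
Qed.

Lemma half_eigenvalue1 : f 1 = k 1%N.
Proof.
rewrite /f (@big_divisorsD1 _ _ _ N 1) //= divnn !mul1r mulr1.
by rewrite big1 ?addr0 // => q /andP[]; rewrite dvdn1 => ->.
Qed.

(** Modulo 2 only the term p = 1 survives: for p even the factor p is even, and
    for odd p > 1 the coefficient vanishes. *)
Lemma odd_half_eigenvalue : (forall p, (p %| N)%N -> odd p -> (1 < p)%N -> k p = 0) ->
  odd `|k 1%N| -> forall j, odd `|f j| = odd j.
Proof.
move=> k0 k1 j; rewrite /f odd_absz_sum (@big_divisorsD1 _ _ _ N 1) //=.
rewrite big_seq_cond big1 => [|q].
  by rewrite divn1 !abszM !oddM odd_chi4 k1 /= addbF.
rewrite -dvdn_divisors // => /and3P[qN qj q1].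
have [par|/negbTE par] := boolP (odd q); last by rewrite !abszM !oddM par.
by rewrite k0 ?mulr0 ?mul0r //; have := dvdn_gt0 N0 qN; lia.
Qed.

(** At an odd divisor p of N the terms of f are odd multiples of the k q, with
    q | p.  Induction on p leaves f p = k 1 + k p modulo 2, and f 1 = k 1. *)
Lemma even_deconvolution : (forall j, (j %| N)%N -> odd j -> odd `|f j| = odd `|f 1|) ->
  forall p, (p %| N)%N -> odd p -> (1 < p)%N -> ~~ odd `|k p|.
Proof.
move=> fodd p; have [m] := ubnP p; elim: m p => // m IH p pm pN po p1.
have := fodd p pN po.
rewrite half_eigenvalue1 /f odd_absz_sum (@big_divisorsD1 _ _ _ N 1) //=.
rewrite (@big_divisorsD1 _ _ _ N p) //=; last by rewrite dvdnn; lia.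
rewrite big_seq_cond big1 => [|q].
  rewrite divn1 !abszM !oddM !odd_chi4 divnn (dvdn_gt0 N0 pN) /= !andbT po /= addbF.
  by case: odd; case: odd.
rewrite -dvdn_divisors // => /andP[qN /andP[/andP[qp q1] qnp]].
have qo := dvdn_odd qp po.
have qp' := dvdn_leq (dvdn_gt0 N0 pN) qp; have q0 := dvdn_gt0 N0 qN.
have qk : ~~ odd `|k q| by apply: IH => //; lia.
by rewrite !abszM !oddM (negbTE qk) andbF.
Qed.

Lemma even_weight : (forall p, (p %| N)%N -> odd p -> (1 < p)%N -> ~~ odd `|k p|) ->
  forall p, (p %| N)%N -> odd p -> (1 < p)%N -> ~~ odd `|b p|.
Proof.
move=> ke p pN po p1; rewrite bE // odd_absz_sum big_seq_cond big1 // => q.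
rewrite -dvdn_divisors // abszM oddM odd_chi4 => /andP[qN pq].
have [par|_] := boolP (odd (absz (q %/ p)%N)); last by rewrite andbF.
have qo : odd q by rewrite -(divnK pq) oddM par.
have le := dvdn_leq (dvdn_gt0 N0 qN) pq.
by rewrite (negbTE (ke q _ _ _)) //; lia.
Qed.

End Level.

(** * Gauss sums of the character modulo 4 *)

(** With - i = i ^ 3, this writes chi4 as a combination of the additive characters
    i ^ l and (- i) ^ l modulo 4, which reduces its Gauss sums to geometric
    ones. *)
Lemma chi4_i_power (F : nzRingType) (i : F) (l : nat) : i ^+ 2 = -1 ->
  2 * i * (chi4 l)%:~R = i ^+ l - i ^+ (3 * l).
Proof.
move=> i2; have i3 : i ^+ 3 = - i by rewrite exprS i2 mulrN1.
have i4 : i ^+ 4 = 1 by rewrite (exprM i 2 2) i2 sqrrN expr1n.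
have sgn : (-1) ^+ l = (-1) ^+ (l %% 4) :> F.
  by rewrite -signr_odd -[RHS]signr_odd; congr (_ ^+ _); lia.
rewrite exprM i3 exprNn sgn -!(expr_mod l i4).
have -> : chi4 l = chi4 (l %% 4)%N by apply: chi4_mod; lia.
have : (l %% 4 < 4)%N by rewrite ltn_mod.
case: (l %% 4)%N => [|[|[|[|//]]]] _.
- by rewrite mulr0 expr0 mulr1 subrr.
- by rewrite !expr1 mulr1 mulN1r opprK mulr_natl mulr2n.
- by rewrite mulr0 sqrrN expr1n mul1r subrr.
- by rewrite i3 exprS sqrrN expr1n mulr1 mulN1r opprK mulrN1 mulr_natl mulr2n opprD.
Qed.

Lemma sum_root_of_unity (F : idomainType) (M : nat) (z : F) : z ^+ M = 1 ->
  \sum_(l < M) z ^+ l = if z == 1 then M%:R else 0.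
Proof.
move=> zM; case: eqP => [->|/eqP z1].
  by under eq_bigr do rewrite expr1n; rewrite sumr_const card_ord.
have : (z - 1) * \sum_(l < M) z ^+ l = 0 by rewrite -subrX1 zM subrr.
by move/eqP; rewrite mulf_eq0 subr_eq0 (negbTE z1) => /eqP.
Qed.

(** Expanding chi4 gives two geometric sums, of ratios z ^ (j + q) and
    z ^ (j + 3q).  At most one of them is not zero, according to the class of
    j / q modulo 4, and both vanish if q does not divide j. *)
Lemma chi4_gauss_sum (F : numFieldType) (i z : F) (q j : nat) :
  i ^+ 2 = -1 -> (4 * q).-primitive_root z -> z ^+ q = i ->
  \sum_(l < 4 * q) (chi4 l)%:~R * z ^+ (j * l) =
  if (q %| j)%N then 2 * i * (q%:Z * chi4 (j %/ q)%N)%:~R else 0.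
Proof.
move=> i2 zprim zq.
have q0 : (0 < q)%N by have := prim_order_gt0 zprim; lia.
have i0 : i != 0.
  by apply: contra_eq_neq i2 => ->; rewrite expr0n eq_sym oppr_eq0 oner_eq0.
have i20 : 2 * i != 0 by rewrite mulf_neq0 // pnatr_eq0.
apply: (mulfI i20).
have geo c : \sum_(l < 4 * q) z ^+ (c * l) = if (4 * q %| c)%N then (4 * q)%:R else 0.
  under eq_bigr do rewrite exprM.
  rewrite sum_root_of_unity ?(prim_order_dvd zprim) //.
  by rewrite -exprM mulnC exprM (prim_expr_order zprim) expr1n.
transitivity (\sum_(l < 4 * q) z ^+ ((j + q) * l) -
  \sum_(l < 4 * q) z ^+ ((j + 3 * q) * l)).
  rewrite mulr_sumr -sumrB; apply: eq_bigr => l _.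
  rewrite mulrA chi4_i_power // mulrBl -zq -!exprM -!exprD.
  by congr (z ^+ _ - z ^+ _); lia.
rewrite !geo; case: (boolP (q %| j)%N) => [/dvdnP[c ->]|qj].
  rewrite mulnK // -mulSnr -mulnDl !dvdn_pmul2r //.
  have -> : 2 * i * (2 * i * (q%:Z * chi4 c)%:~R) = - (4 * q)%:R * (chi4 c)%:~R :> F.
    by rewrite intrM natrM -[in RHS](mulN1r (4%:R * _)) -i2 -pmulrn; ring.
  rewrite /chi4; case: (modz4P c) => e; rewrite e /=.
  - by rewrite !ifF ?subrr ?mulr0 //; lia.
  - by rewrite ifF 1?ifT ?sub0r ?mulr1 //; lia.
  - by rewrite !ifF ?subrr ?mulr0 //; lia.
  - by rewrite ifT 1?ifF ?subr0 ?mulrN1 ?opprK //; lia.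
have qM : (q %| 4 * q)%N by rewrite dvdn_mull.
by rewrite !ifF ?subrr ?mulr0 //; apply: contraNF qj => /(dvdn_trans qM);
  rewrite dvdn_addl // dvdn_mull.
Qed.

(** * The adjacency matrix as a function of gcds *)

Lemma intr_Zp_eq0 (n : nat) (z : int) : (1 < n)%N ->
  ((z%:~R : 'Z_n) == 0) = (n%:Z %| z)%Z.
Proof.
move=> n1; have nat0 (m : nat) : ((m%:R : 'Z_n) == 0) = (n %| m)%N.
  by rewrite -val_eqE /= val_Zp_nat.
by case: z => m; rewrite ?NegzE ?mulrNz ?oppr_eq0 ?dvdzN ?dvdzE -?pmulrn nat0.
Qed.

Section Connection.
Variables (N : nat) (D : set nat) (sigma : nat -> int).
Hypothesis N0 : (0 < N)%N.
Hypothesis D_div : forall d : nat, D d -> (d %| N)%N.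
Hypothesis sigma_pm1 : forall d : nat, D d -> sigma d = 1 \/ sigma d = -1.
Local Notation n := (4 * N)%N.

(** The class of z determines gcd (z, n), hence the only d in D whose part
    S_n(d) may contain it.  The residue modulo 4 of z / d is well defined
    because 4 divides n / d. *)
Lemma mem_connection_set (z : int) :
  (z%:~R \in connection_set n D sigma) =
  `[< D (gcdn `|z| n) >] && (chi4 (z %/ gcdn `|z| n)%Z == sigma (gcdn `|z| n)).
Proof.
have n1 : (1 < n)%N by lia.
have n0 : (0 < n)%N by lia.
set g := gcdn `|z| n.
have g0 : (0 < g)%N by rewrite gcdn_gt0 n0 orbT.
have gz : (g%:Z %| z)%Z by rewrite dvdzE dvdn_gcdl.
apply/idP/andP.
  rewrite inE => -[d Dd].
  suff H (r : int) : Gnr n r d z%:~R -> g = d /\ chi4 (z %/ d)%Z = chi4 r.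
    have [sd|sd] := sigma_pm1 Dd; rewrite /Sn sd /= => /H[-> ->].
      by split; [apply/asboolP | rewrite sd].
    by split; [apply/asboolP | rewrite sd].
  move=> [k [kr gk /eqP]]; rewrite -subr_eq0 -mulrzBr intr_Zp_eq0 // => /dvdzP[c zc].
  have zE : z = c * n%:Z + d%:Z * k by rewrite -zc subrK.
  have gd : g = d.
    have : gcdz z n%:Z = d%:Z by rewrite zE gcdzC gcdzMDl gcdzC.
    by rewrite /gcdz /= => -[].
  split=> //; rewrite -(@chi4_mod _ _ kr); apply: chi4_mod.
  have [e Ne] := dvdnP (D_div Dd).
  rewrite zE Ne; have d0 : d%:Z != 0 by rewrite -gd; lia.
  have -> : c * (4 * (e * d))%N%:Z + d%:Z * k = (c * 4 * e%:Z + k) * d%:Z.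
    by rewrite !PoszM; ring.
  by rewrite mulzK // mulrAC modzMDl.
move=> [/asboolP Dg /eqP cg]; apply/mem_set; exists g => //.
rewrite /Sn; have gk : g%:Z * (z %/ g)%Z = z by rewrite mulrC divzK.
have [sg|sg] := sigma_pm1 Dg; rewrite sg /=; exists (z %/ g)%Z; split; rewrite ?gk //.
- by move: cg; rewrite sg /chi4; case: (modz4P (z %/ g)%Z) => ->.
- by move: cg; rewrite sg /chi4; case: (modz4P (z %/ g)%Z) => ->.
Qed.

Definition divisor_sign (d : nat) : int := if `[< D d >] then sigma d else 0.

(** The difference of the indicators of the connection set and of its opposite,
    in closed form. *)
Definition signed_indicator (s : nat) : int :=
  divisor_sign (gcdn s n) * chi4 (s %/ gcdn s n)%N.

(** As chi4 is odd, s and - s are never both in the connection set, and the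
    three cases merge into one formula. *)
Lemma adjacency_entry (F : nzRingType) (i : F) (s : 'Z_n) :
  (if s \in connection_set n D sigma then i
   else if - s \in connection_set n D sigma then - i else 0) =
  i * (signed_indicator s)%:~R.
Proof.
have n0 : (0 < n)%N by lia.
have sE : s = (s : nat)%:Z%:~R by rewrite -pmulrn natr_Zp.
rewrite [in X in if X then _ else _]sE [in X in - X]sE -mulrNz.
rewrite !mem_connection_set abszN absz_nat.
rewrite /signed_indicator /divisor_sign; set g := gcdn s n.
have gs : (g%:Z %| s%:Z)%Z by rewrite dvdzE dvdn_gcdl.
have gpos : (0 < g)%N by rewrite gcdn_gt0 n0 orbT.
have g0 : g%:Z != 0 by lia.
have sg : (s : nat)%:Z = (s %/ g)%N%:Z * g%:Z by rewrite -PoszM divnK // dvdn_gcdl.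
have -> : ((- s%:Z) %/ g)%Z = - ((s %/ g)%N : int).
  by rewrite sg -mulNr mulzK.
have -> : (s%:Z %/ g)%Z = (s %/ g)%N by rewrite divz_nat.
rewrite chi4N; case: asboolP => [Dg|_]; last by rewrite mul0r mulr0.
have [-> | ->] := sigma_pm1 Dg; rewrite /chi4;
  case: (modz4P (s %/ g)%N) => -> /=; rewrite ?mulr0 ?mulr1 ?mulrN1 //.
Qed.

(** A term of [signed_indicatorE] at an s whose gcd with n does not divide N
    must vanish: the argument of chi4 is then even. *)
Lemma gcd_odd_quotient (p s : nat) : (p %| N)%N -> (N %| p * s)%N ->
  odd (p * s %/ N) -> (gcdn s n %| N)%N.
Proof.
move=> /dvdnP[m Nm] /dvdnP[c psE].
have p0 : (0 < p)%N by move: N0; rewrite Nm; case: (p) => //; rewrite muln0.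
rewrite psE mulnK // => co.
have -> : s = (m * c)%N.
  by apply/eqP; rewrite -(eqn_pmul2l p0) psE Nm; apply/eqP; lia.
have -> : n = (m * (4 * p))%N by rewrite Nm; lia.
rewrite -muln_gcdr Nm dvdn_pmul2l; last by move: N0; rewrite Nm; case: (m).
by rewrite Gauss_gcdr ?dvdn_gcdr // (coprimeXr 2 (m := c) (n := 2)) // coprimen2.
Qed.

(** With g = gcd (s, n) = N / q and s = g s', the integer s' is prime to q, so
    N | p s means q | p and p s / N = (p / q) s'.  By multiplicativity of
    chi4 the formula is thus chi4 s' times the one at s = g, which is the
    hypothesis on k. *)
Lemma signed_indicatorE (k : nat -> int) :
  (forall q, (q %| N)%N -> divisor_sign (N %/ q) =
    \sum_(p <- divisors N | (q %| p)%N) k p * chi4 (p %/ q)%N) ->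
  forall s, signed_indicator s =
    \sum_(p <- divisors N | (N %| p * s)%N) k p * chi4 (p * s %/ N)%N.
Proof.
move=> kE s; rewrite /signed_indicator; set g := gcdn s n.
have n0 : (0 < n)%N by lia.
have g0 : (0 < g)%N by rewrite gcdn_gt0 n0 orbT.
have [gN|gN] := boolP (g %| N)%N; last first.
  rewrite /divisor_sign asboolF ?mul0r; last by move=> /D_div; rewrite (negbTE gN).
  rewrite big_seq_cond big1 // => p; rewrite -dvdn_divisors // => /andP[pN Nps].
  rewrite chi4_even ?mulr0 //; apply: contra gN; exact: gcd_odd_quotient.
have qN : (N %/ g %| N)%N by apply: dvdn_div.
have [q Nq] := dvdnP gN; have q0 : (0 < q)%N by move: N0; rewrite Nq; case: (q).
have [s' sE] := dvdnP (dvdn_gcdl s n : (g %| s)%N).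
have cop : coprime q s'.
  have : (gcdn s' (4 * q) * g = g)%N.
    by rewrite muln_gcdl -sE -mulnA -Nq.
  move=> /eqP; rewrite -[X in _ == X]mul1n eqn_pmul2r // => /eqP g1.
  rewrite coprime_sym; apply: (coprime_dvdr (dvdn_mull 4 (dvdnn q))).
  by rewrite /coprime g1.
have -> : g = (N %/ q)%N by rewrite Nq mulKn.
rewrite kE; last by rewrite Nq dvdn_mulr.
rewrite mulr_suml big_mkcond [RHS]big_mkcond; apply: eq_bigr => p _.
have NdvE : (N %| p * s)%N = (q %| p)%N.
  by rewrite Nq sE mulnA dvdn_pmul2r // Gauss_dvdl.
rewrite NdvE; case: ifP => // qp; rewrite -mulrA -chi4M -PoszM.
have -> : (s %/ (N %/ q) = s')%N by rewrite Nq mulKn // sE mulnK.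
congr (_ * chi4 _%:Z).
by rewrite Nq sE mulnA divnMr // divn_mulAC.
Qed.

End Connection.

(** * Matrix exponential and complex exponential *)

(** The partial sums of the series are combinations, with the scalar partial
    sums as coefficients, of the fixed matrices invmx W *m delta_mx j j *m W;
    so the convergence of scalar series is enough. *)
Lemma mxexp_diagonalizable (K : numFieldType) (m : nat)
    (A W : 'M[K]_m.+1) (d e : 'rV[K]_m.+1) :
  W \in unitmx -> W *m A = diag_mx d *m W ->
  (forall j, series (fun k => (k`!%:R)^-1 * d 0 j ^+ k) @ \oo --> e 0 j) ->
  W *m mxexp A = diag_mx e *m W.
Proof.
move=> Wu WA cv.
have AE : A = invmx W *m diag_mx d *m W by rewrite -mulmxA -WA mulKmx.
have WAk k : W *m A ^+ k = diag_mx (map_mx (fun x => x ^+ k) d) *m W.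
  elim: k => [|k IH].
    rewrite expr0 mulmx1 -[LHS]mul1mx; congr (_ *m _).
    by apply/matrixP => i j; rewrite !mxE expr0.
  rewrite exprSr mulmxA IH -mulmxA WA mulmxA mulmx_diag; congr (diag_mx _ *m _).
  by apply/rowP => j; rewrite !mxE exprSr.
pose P j := invmx W *m delta_mx j j *m W.
have diagE (v : 'rV[K]_m.+1) : invmx W *m (diag_mx v *m W) = \sum_j v 0 j *: P j.
  rewrite diag_mx_sum_delta mulmx_suml mulmx_sumr; apply: eq_bigr => j _.
  by rewrite -scalemxAl -scalemxAr mulmxA.
suff expA : mxexp A = invmx W *m (diag_mx e *m W) by rewrite expA mulKVmx.
rewrite diagE /mxexp; apply: cvg_lim; first exact: norm_hausdorff.
have -> : series (fun k => (k`!%:R)^-1 *: A ^+ k) =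
    fun n => \sum_j series (fun k => (k`!%:R)^-1 * d 0 j ^+ k) n *: P j.
  apply/funext => n; rewrite /series /=.
  transitivity (\sum_(0 <= k < n) \sum_j ((k`!%:R)^-1 * d 0 j ^+ k) *: P j).
    apply: eq_bigr => k _; rewrite -(mulKmx Wu (A ^+ k)) WAk diagE scaler_sumr.
    by apply: eq_bigr => j _; rewrite mxE scalerA.
  by rewrite exchange_big; apply: eq_bigr => j _; rewrite scaler_suml.
apply: cvg_big => [|j _]; first exact: add_continuous.
by apply: cvgZr_tmp; apply: cv.
Qed.

Section Expi.
Variable R : realType.
Implicit Types x y : R.

(** The value exp (i x). *)
Definition expi x : R[i] := (cos x +i* sin x)%C.

Lemma expi0 : expi 0 = 1.
Proof. by rewrite /expi cos0 sin0. Qed.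

Lemma expiD x y : expi (x + y) = expi x * expi y.
Proof.
rewrite /expi cosD sinD; apply/eqP; rewrite eq_complex /= eqxx /=.
by rewrite addrC [sin x * _]mulrC [cos y * _]mulrC eqxx.
Qed.

Lemma expi_nat x k : expi (x *+ k) = expi x ^+ k.
Proof. by elim: k => [|k IH]; rewrite ?expi0 // mulrS exprS expiD IH. Qed.

Lemma expi_unit x : expi x \is a GRing.unit.
Proof.
by apply/unitrPr; exists (expi (- x)); rewrite -expiD subrr expi0.
Qed.

Lemma expiN x : expi (- x) = (expi x)^-1.
Proof.
by apply: (mulrI (expi_unit x)); rewrite -expiD subrr expi0 divrr ?expi_unit.
Qed.

Lemma expi_int x (z : int) : expi (x *~ z) = expi x ^ z.
Proof.
case: z => k; first by rewrite -exprnP -expi_nat.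
by rewrite NegzE mulrNz expiN -exprnN -pmulrn expi_nat.
Qed.

Lemma expi_pi : expi pi = -1.
Proof. by rewrite /expi cospi sinpi; apply/eqP; rewrite eq_complex /= oppr0 !eqxx. Qed.

Lemma expi_pihalf : expi (pi / 2) = 'i.
Proof. by rewrite /expi cos_pihalf sin_pihalf -complexiE. Qed.

Lemma expi_neq1 x : 0 < x < 2 * pi -> expi x != 1.
Proof.
move=> /andP[x0 x2]; apply/eqP => -[cx _].
have sx : 0 < sin (x / 2).
  by apply: sin_gt0_pi; rewrite divr_gt0 //= ltr_pdivrMr // mulrC.
have xE : x / 2 *+ 2 = x by rewrite -mulr_natr divfK ?pnatr_eq0.
have := cos_mulr2n (x / 2); rewrite xE cx cos2sin2.
move=> /eqP; rewrite -subr_eq0.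
have -> : 1 - ((1 - sin (x / 2) ^+ 2) *+ 2 - 1) = 2 * sin (x / 2) ^+ 2 by ring.
by rewrite mulf_eq0 pnatr_eq0 /= expf_eq0 /= gt_eqF.
Qed.

Lemma expi_prim_root n : (0 < n)%N -> n.-primitive_root (expi (2 * pi / n%:R)).
Proof.
move=> n0; apply/andP; split => //; apply/forallP => j; rewrite unity_rootE -expi_nat.
have nz : n%:R != 0 :> R by rewrite pnatr_eq0 -lt0n.
apply/eqP; case: (eqVneq j.+1 n) => [->|jn].
  by rewrite -(mulr_natr (_ / _)) divfK // mulr_natl expi_nat expi_pi sqrrN expr1n eqxx.
apply/negbTE/expi_neq1; rewrite -(mulr_natr (_ / _)) mulrAC -mulrA.
have pi2 : 0 < 2 * pi :> R by rewrite mulr_gt0 ?pi_gt0.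
rewrite mulr_gt0 ?divr_gt0 ?ltr0n //= gtr_pMr // ltr_pdivrMr ?ltr0n // mul1r ltr_nat.
by rewrite ltn_neqAle jn /=.
Qed.

(** The topology of R[i] is found through its structure of numFieldType. *)
Local Notation complexR := (R[i] : numFieldType).

Lemma cvg_real_complex (u : R^nat) (l : R) : u @ \oo --> l ->
  (fun n => (u n)%:C%C : complexR) @ \oo --> (l%:C%C : complexR).
Proof.
move=> ul; apply/cvgrPdist_lt => eps eps0.
have epsR : eps = (complex.Re eps)%:C%C :> R[i] by rewrite RRe_real // gtr0_real.
move: eps0; rewrite epsR ltcR => eps0.
move/cvgrPdist_lt : ul => /(_ _ eps0); apply: filterS => n.
by rewrite -rmorphB /= normc_def /= expr0n addr0 sqrtr_sqr ltcR.
Qed.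

(** The powers of i split the series into those of cos and sin. *)
Lemma expi_series x :
  series (fun k => (k`!%:R)^-1 * ('i * x%:C%C) ^+ k : complexR) @ \oo -->
    (expi x : complexR).
Proof.
have termE k : (k`!%:R)^-1 * ('i * x%:C%C) ^+ k =
    (cos_coeff x k)%:C%C + 'i * (sin_coeff x k)%:C%C :> R[i].
  have fE : (k`!%:R)^-1 = (k`!%:R^-1 : R)%:C%C :> R[i] by rewrite fmorphV rmorph_nat.
  rewrite exprMn -rmorphXn fE -[k in 'i ^+ k]odd_double_half exprD -mul2n exprM sqrCi.
  rewrite /cos_coeff /sin_coeff /= -exprnP !rmorphM !rmorphXn !rmorphN1 !rmorph_nat.
  case ko: (odd k); last by rewrite expr0 /=; ring.
  by rewrite (_ : k.-1./2 = k./2) ?expr1 /=; [ring | lia].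
rewrite (_ : series _ = fun n => (series (cos_coeff x) n)%:C%C +
    'i * (series (sin_coeff x) n)%:C%C); last first.
  apply/funext => n; rewrite /series /= !rmorph_sum mulr_sumr -big_split.
  by apply: eq_bigr => k _; rewrite termE.
have -> : expi x = (cos x)%:C%C + 'i * (sin x)%:C%C.
  rewrite -complexiE; apply/eqP; rewrite eq_complex /=.
  by rewrite !mul0r !mul1r subr0 addr0 !add0r !eqxx.
apply: (@cvgD complexR complexR); first apply: cvg_real_complex.
  by have := @is_cvg_series_cos_coeff R x; rewrite unlock.
apply: cvgMl_tmp; apply: cvg_real_complex.
by have := @is_cvg_series_sin_coeff R x; rewrite unlock.
Qed.

End Expi.

(** * Sums over multiples and roots of unity *)

Lemma big_multiples (V : nmodType) (m M : nat) (F : nat -> V) : (0 < m)%N ->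
  \sum_(s < M * m | (m %| s)%N) F s = \sum_(l < M) F (l * m)%N.
Proof.
move=> m0; rewrite big_mkcond -(big_mkord predT (fun s => if (m %| s)%N then F s else 0)).
rewrite big_nat_mul big_mkord; apply: eq_bigr => l _.
rewrite big_ltn; last by rewrite ltn_pmul2r.
rewrite dvdn_mull // big_nat big1 => [|s /andP[s1 s2]]; first exact: addr0.
case: ifP => // /dvdnP[c sE]; move: s1 s2; rewrite sE !ltn_pmul2r //; lia.
Qed.

Lemma prim_rootV (F : fieldType) (n : nat) (z : F) :
  n.-primitive_root z -> n.-primitive_root z^-1.
Proof.
case/andP=> n0 /forallP zp; apply/andP; split => //; apply/forallP => j.
by rewrite unity_rootE exprVn invr_eq1 -unity_rootE; apply: zp.
Qed.

(** * The Fourier transform of the adjacency matrix *)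

Section Spectrum.
Variables (N : nat) (D : set nat) (sigma : nat -> int) (k : nat -> int).
Hypothesis N0 : (0 < N)%N.
Hypothesis D_div : forall d : nat, D d -> (d %| N)%N.
Hypothesis sigma_pm1 : forall d : nat, D d -> sigma d = 1 \/ sigma d = -1.
Hypothesis kE : forall q, (q %| N)%N -> divisor_sign D sigma (N %/ q) =
    \sum_(p <- divisors N | (q %| p)%N) k p * chi4 (p %/ q)%N.
Local Notation n := (4 * N)%N.
Local Notation f := (half_eigenvalue N k).

(** The term of index p lives on the multiples s = l m of m = N / p, where it is
    k p times chi4 l, and z ^ m is a primitive root of order 4p. *)
Lemma fourier_signed_indicator (F : numFieldType) (i z : F) (j : nat) :
  i ^+ 2 = -1 -> n.-primitive_root z -> z ^+ N = i ->
  \sum_(s < n) (signed_indicator N D sigma s)%:~R * z ^+ (j * s) = 2 * i * (f j)%:~R.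
Proof.
move=> i2 zp zN.
under eq_bigr => s _ do
  rewrite (signed_indicatorE N0 D_div kE) big_mkcond /= rmorph_sum mulr_suml.
rewrite exchange_big /half_eigenvalue [in RHS]big_mkcond rmorph_sum mulr_sumr.
rewrite big_seq [RHS]big_seq; apply: eq_bigr => p; rewrite -dvdn_divisors // => pN.
have [m Nm] := dvdnP pN.
have m0 : (0 < m)%N by move: N0; rewrite Nm; case: (m).
have p0 := dvdn_gt0 N0 pN.
transitivity ((k p)%:~R * \sum_(s < 4 * p * m | (m %| s)%N)
    (chi4 (s %/ m)%N)%:~R * z ^+ (j * s)).
  have -> : (4 * p * m = 4 * N)%N by rewrite Nm; lia.
  rewrite mulr_sumr [RHS]big_mkcond; apply: eq_bigr => s _.
  have -> : (N %| p * s)%N = (m %| s)%N.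
    by move: (s : nat) => t; rewrite Nm mulnC dvdn_pmul2l.
  have -> : (p * s %/ N = s %/ m)%N.
    by move: (s : nat) => t; rewrite Nm mulnC divnMr.
  by case: ifP => _ /=; rewrite ?mul0r // intrM mulrA.
rewrite (big_multiples _ (fun s => (chi4 (s %/ m)%N)%:~R * z ^+ (j * s))) //.
have zp' : (4 * p).-primitive_root (z ^+ m).
  have -> : m = (n %/ (4 * p))%N by rewrite Nm mulnA mulnAC mulKn //; lia.
  by apply: dvdn_prim_root => //; rewrite dvdn_pmul2l.
have zp'i : (z ^+ m) ^+ p = i by rewrite -exprM -Nm.
have gauss := chi4_gauss_sum j i2 zp' zp'i.
transitivity ((k p)%:~R *
    (if (p %| j)%N then 2 * i * (p%:Z * chi4 (j %/ p)%N)%:~R else 0)).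
  rewrite -gauss; congr (_ * _); apply: eq_bigr => l _.
  by rewrite mulnK // -exprM; congr (_ * z ^+ _); lia.
case: ifP => _; last by rewrite !mulr0.
by rewrite !intrM; ring.
Qed.

Definition dft (F : nzRingType) (z : F) : 'M[F]_((Zp_trunc n).+2) :=
  \matrix_(j, v) z ^+ (j * v).

Lemma card_Zn : (Zp_trunc n).+2 = n.
Proof. by rewrite Zp_cast //; lia. Qed.

Lemma ltn_Zn (j : 'Z_n) : (j < n)%N.
Proof. exact: leq_trans (ltn_ord j) (eq_leq card_Zn). Qed.

Lemma val_ZnD (x y : 'Z_n) : (x + y)%R = ((x + y) %% n)%N :> nat.
Proof. by congr (_ %% _)%N; exact: card_Zn. Qed.

Lemma big_Zn (V : nmodType) (F : nat -> V) : \sum_(s : 'Z_n) F s = \sum_(s < n) F s.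
Proof. by rewrite -!(big_mkord predT) card_Zn. Qed.

Lemma dft_unit (F : numFieldType) (z : F) :
  n.-primitive_root z -> dft z \in unitmx.
Proof.
move=> zp; have n0 := prim_order_gt0 zp.
have z0 : z != 0 by rewrite (prim_root_eq0 zp) -lt0n.
have nz : n%:R != 0 :> F by rewrite pnatr_eq0 -lt0n.
suff H : dft z *m (n%:R^-1 *: dft z^-1) = 1%:M by have [] := mulmx1_unit H.
rewrite -scalemxAr; apply/matrixP => j j'; rewrite !mxE.
transitivity (n%:R^-1 * \sum_(s < (Zp_trunc n).+2) (z ^+ j * z ^- j') ^+ s).
  congr (_ * _); apply: eq_bigr => s _.
  by rewrite !mxE exprMn -!exprVn -!exprM [(s * j')%N]mulnC.
have rootE : (z ^+ j * z ^- j') ^+ (Zp_trunc n).+2 = 1.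
  rewrite [X in _ ^+ X]card_Zn exprMn exprVn (exprAC z j) (exprAC z j').
  by rewrite (prim_expr_order zp) !expr1n invr1 mulr1.
rewrite sum_root_of_unity //; have -> : (z ^+ j * z ^- j' == 1) = (j == j').
  rewrite -(inj_eq (mulIf (expf_neq0 j' z0))) mulfVK ?expf_neq0 // mul1r.
  by rewrite (eq_prim_root_expr zp) !modn_small // ltn_Zn.
case: (j == j'); last by rewrite mulr0.
by rewrite card_Zn mulVf.
Qed.

Section PST.
Variable R : realType.
Local Notation H := (hermitian_adjacency R (IOCG n D sigma)).
Local Notation omega := (expi (2 * pi / n%:R) : R[i]).

Lemma omega_prim : n.-primitive_root omega.
Proof. by apply: expi_prim_root; lia. Qed.

Lemma omegaN : omega ^+ N = 'i.
Proof.
rewrite -expi_nat -expi_pihalf; congr expi; rewrite -(mulr_natr (_ / _)) natrM.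
have : N%:R != 0 :> R by rewrite pnatr_eq0 -lt0n.
by move=> ?; field.
Qed.

(** Substituting u = v - s in the sum over u turns the coefficient of
    omega ^ (j v) into the transform of the signed indicator at the inverse root
    omega^-1, for which - i plays the role of i. *)
Lemma dft_eigen :
  dft omega *m H = diag_mx (\row_j (2 * f j)%:~R) *m dft omega.
Proof.
apply/matrixP => j v; rewrite mul_diag_mx !mxE.
transitivity (\sum_(s : 'Z_n) omega ^+ (j * v) *
    ('i * ((signed_indicator N D sigma s)%:~R * omega^-1 ^+ (j * s)))).
  rewrite (reindex_inj (subrI v)); apply: eq_bigr => s _.
  have e1 : v - (v - s) = s by rewrite subKr.
  have e2 : v - s - v = - s by rewrite addrAC subrr add0r.
  rewrite !mxE /IOCG e1 e2 (adjacency_entry N0 D_div sigma_pm1).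
  have <- : omega ^+ (j * (v - s)%R) * omega ^+ (j * s) = omega ^+ (j * v).
    rewrite -exprD -mulnDr; apply/eqP; rewrite (eq_prim_root_expr omega_prim).
    by rewrite -[v in X in _ == X](subrK s v) (val_ZnD (v - s) s) modnMmr.
  have w0 : omega != 0 by rewrite (prim_root_eq0 omega_prim); lia.
  by rewrite exprVn; field; rewrite expf_neq0.
rewrite -!mulr_sumr.
rewrite (big_Zn (fun s => (signed_indicator N D sigma s)%:~R *
  omega^-1 ^+ (j * s))).
rewrite (@fourier_signed_indicator _ (- 'i)) ?sqrrN ?sqrCi //; first last.
- by rewrite exprVn omegaN invCi.
- exact: prim_rootV omega_prim.
have -> : 'i * (2 * - 'i * (f j)%:~R) = - 'i ^+ 2 * 2 * (f j)%:~R :> R[i] by ring.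
by rewrite sqrCi opprK mul1r intrM mulrC.
Qed.

Lemma dft_transition (t : R) :
  dft omega *m transition_matrix (IOCG n D sigma) t =
  diag_mx (\row_j expi (2 * t) ^ f j) *m dft omega.
Proof.
apply: (mxexp_diagonalizable (K := R[i]) (d := \row_j ('i * (t * 2 *~ f j)%:C%C))).
- exact: dft_unit omega_prim.
- rewrite -scalemxAr dft_eigen scalemxAl; congr (_ *m _).
  apply/matrixP => i j; rewrite !mxE; case: (i == j); rewrite ?mulr0n ?mulr1n ?mulr0 //.
  by rewrite raddfMz /= -[_ *~ f _]mulrzr intrM rmorphM rmorph_nat; ring.
- move=> j; rewrite !mxE -expi_int.
  have -> : 2 * t *~ f j = t * 2 *~ f j by rewrite [2 * t]mulrC.
  exact: expi_series.
Qed.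

(** The invertible Fourier matrix turns both sides into vectors of coordinates
    that differ from omega ^ (j b) by the displayed factors, the sign coming
    from omega ^ (n / 2) = -1. *)
Lemma transfer_half_turnP (b : 'Z_n) (t : R) (gamma : R[i]) :
  transition_matrix (IOCG n D sigma) t *m basis_vector R (b + (n %/ 2)%:R) =
    gamma *: basis_vector R b
  <-> forall j : 'Z_n, expi (2 * t) ^ f j * (-1) ^+ j = gamma.
Proof.
have w0 : omega != 0 by rewrite (prim_root_eq0 omega_prim); lia.
have half : ((n %/ 2)%:R : 'Z_n) = (2 * N)%N :> nat.
  have -> : (n %/ 2 = 2 * N)%N by rewrite -(mulnA 2 2 N) mulKn.
  by rewrite val_Zp_nat ?modn_small // ?ltn_pmul2r //; lia.
have shift j : omega ^+ (j * (b + (n %/ 2)%:R : 'Z_n)%R) = omega ^+ (j * b) * (-1) ^+ j.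
  have -> : (-1) ^+ j = omega ^+ (j * (2 * N)) :> R[i].
    by rewrite [(j * _)%N]mulnC exprM (mulnC 2) exprM omegaN sqrCi.
  rewrite -exprD -mulnDr; apply/eqP; rewrite (eq_prim_root_expr omega_prim).
  by rewrite val_ZnD modnMmr half.
have coord (w : 'Z_n) : dft omega *m basis_vector R w = \col_j omega ^+ (j * w).
  by rewrite -colE; apply/colP => j; rewrite !mxE.
have lhs : dft omega *m (transition_matrix (IOCG n D sigma) t *m
    basis_vector R (b + (n %/ 2)%:R)) =
    \col_j (expi (2 * t) ^ f j * (-1) ^+ j * omega ^+ (j * b)).
  rewrite mulmxA dft_transition -mulmxA coord; apply/colP => j.
  by rewrite mul_diag_mx !mxE shift mulrA mulrAC.
have rhs : dft omega *m (gamma *: basis_vector R b) =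
    \col_j (gamma * omega ^+ (j * b)).
  by rewrite -scalemxAr coord; apply/colP => j; rewrite !mxE.
split=> [e j | e].
  have := congr1 (mulmx (dft omega)) e; rewrite lhs rhs.
  by move/colP/(_ j); rewrite !mxE; apply: mulIf; rewrite expf_neq0.
apply: (can_inj (mulKmx (dft_unit omega_prim))); rewrite lhs rhs.
by apply/colP => j; rewrite !mxE e.
Qed.

End PST.
End Spectrum.

(** * Integral powers of -1 and the level two *)

Lemma exprzN1 (F : unitRingType) (z : int) : (-1 : F) ^ z = (-1) ^+ odd `|z|.
Proof.
case: z => m; first by rewrite signr_odd.
by rewrite NegzE abszN signr_odd -exprnN -exprVn invrN1.
Qed.

(** Compute y ^ (a b) in two ways. *)
Lemma same_parity_of_exprz_eqN1 (F : numFieldType) (y : F) (a b : int) :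
  y ^ a = -1 -> y ^ b = -1 -> odd `|a| = odd `|b|.
Proof.
move=> ya yb.
have : (y ^ a) ^ b = (y ^ b) ^ a by rewrite !exprz_exp mulrC.
rewrite ya yb !exprzN1 => /eqP; have N11 : (-1 == 1 :> F) = false.
  by rewrite eqNr oner_eq0.
by case: (odd `|a|); case: (odd `|b|); rewrite ?expr0 ?expr1 ?N11 // eq_sym N11.
Qed.

Lemma odd_divisor_sign (D : set nat) (sigma : nat -> int) (d : nat) :
  (forall d : nat, D d -> sigma d = 1 \/ sigma d = -1) ->
  odd `|divisor_sign D sigma d| = `[< D d >].
Proof.
by move=> pm1; rewrite /divisor_sign; case: asboolP => // /pm1[] ->.
Qed.

Lemma Dlevel2P (N : nat) (D : set nat) (d : nat) : (0 < N)%N ->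
  (forall d : nat, D d -> (d %| N)%N) ->
  Dlevel (4 * N) D 2 d <-> D d /\ odd (N %/ d).
Proof.
move=> N0 D_div.
have levelE : D d -> (logn 2 (4 * N %/ d) == 2) = odd (N %/ d).
  move=> /D_div dN; rewrite -muln_divA //.
  have q0 : (0 < N %/ d)%N.
    by rewrite divn_gt0; [apply: dvdn_leq | apply: dvdn_gt0 dN].
  have -> : logn 2 (4 * (N %/ d)) = (2 + logn 2 (N %/ d))%N by rewrite lognM.
  rewrite -[RHS]negbK -dvdn2.
  have := logn_gt0 2 (N %/ d); rewrite mem_primes q0 /= => <-.
  by case: (logn 2 _).
by split=> -[Dd]; [move=> /eqP | move=> o; split=> //; apply/eqP]; rewrite levelE.
Qed.

Theorem theorem1p2 (R : realType) (n : nat) (D : set nat) (sigma : nat -> int)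
    (n_gt0 : (0 < n)%N) (n_mod4 : (4 %| n)%N)
    (D_neq0 : D !=set0)
    (D_div : forall d : nat, D d -> (0 < d)%N /\ (d %| n %/ 4)%N)
    (sigma_pm1 : forall d : nat, D d -> sigma d = 1 \/ sigma d = -1) :
  (forall b : 'Z_n,
     perfect_state_transfer R (IOCG n D sigma) (b + (n %/ 2)%:R) b)
  <->
  ((4 %| n)%N /\ Dlevel n D 2 = [set (n %/ 4)%N]).
Proof.
move: n_mod4 (n_mod4) => /dvdnP[N nE] n_mod4; rewrite mulnC in nE; subst n.
rewrite mulKn // in D_div; rewrite mulKn //.
have N0 : (0 < N)%N by lia.
have {}D_div d : D d -> (d %| N)%N by move=> /D_div[].
have signed_eq0 d : ~ D d -> divisor_sign D sigma d = 0 by rewrite /divisor_sign => /asboolF ->.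
have [k kE] := chi4_deconvolution (fun q => divisor_sign D sigma (N %/ q)) N0.
have f1 := half_eigenvalue1 N0 k.
split=> [pst | [_ level]].
  have [t [gamma [_ /(transfer_half_turnP N0 D_div sigma_pm1 kE) e]]] := pst 0.
  have f0 : half_eigenvalue N k 0 = 0.
    by rewrite /half_eigenvalue big1 // => p _; rewrite div0n chi4_even // mulr0.
  have gamma1 : gamma = 1 by rewrite -(e 0) /= f0 expr0z mulr1.
  have yf j : (j %| N)%N -> odd j -> expi (2 * t) ^ half_eigenvalue N k j = -1.
    move=> jN jo; have jle := dvdn_leq N0 jN.
    have := e j%:R; rewrite val_Zp_nat; last by lia.
    rewrite modn_small; last by lia.
    by rewrite -signr_odd jo expr1 mulrN1 gamma1 => <-; rewrite opprK.
  have f_odd j : (j %| N)%N -> odd j ->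
      odd `|half_eigenvalue N k j| = odd `|half_eigenvalue N k 1|.
    by move=> jN jo; apply: (same_parity_of_exprz_eqN1 (yf _ jN jo)); apply: yf.
  have noD p : (p %| N)%N -> odd p -> (1 < p)%N -> ~ D (N %/ p)%N.
    move=> pN po p1; have := even_weight N0 kE (even_deconvolution N0 f_odd) pN po p1.
    by rewrite odd_divisor_sign // => /asboolP.
  have k_eq0 := deconvolution_eq0 N0 kE (fun p pN po p1 => signed_eq0 _ (noD p pN po p1)).
  have DN : D N.
    apply: contrapT => /signed_eq0 sN; have := yf 1%N (dvd1n N) isT.
    rewrite f1 -(weight1E N0 kE k_eq0) divn1 sN expr0z => /eqP.
    by rewrite eq_sym eqNr oner_eq0.
  split=> //; apply/seteqP; split=> d; last first.
    by move=> /= ->; apply/(Dlevel2P _ N0 D_div); split=> //; rewrite divnn N0 oddb.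
  move=> /(Dlevel2P _ N0 D_div)[Dd o]; have dN := D_div _ Dd.
  have [c Nc] := dvdnP dN; have d0 := dvdn_gt0 N0 dN.
  rewrite Nc mulnK // in o; have c0 : (0 < c)%N by case: (c) o.
  have [c1 | cle1] := ltnP 1 c; last first.
    by rewrite /= Nc (_ : c = 1%N) ?mul1n //; lia.
  by case: (@noD c) => //; rewrite Nc ?mulKn // dvdn_mulr.
have DN : D N by have [] : Dlevel (4 * N) D 2 N by rewrite level.
have noD p : (p %| N)%N -> odd p -> (1 < p)%N -> ~ D (N %/ p)%N.
  move=> pN po p1 Dp; have : Dlevel (4 * N) D 2 (N %/ p)%N.
    apply/(Dlevel2P _ N0 D_div); split=> //.
    by rewrite divnA // mulKn.
  by rewrite level /= => pE; have := ltn_Pdiv p1 N0; rewrite pE ltnn.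
have k_eq0 := deconvolution_eq0 N0 kE (fun p pN po p1 => signed_eq0 _ (noD p pN po p1)).
have k1_odd : odd `|k 1%N|.
  by rewrite -(weight1E N0 kE k_eq0) divn1 odd_divisor_sign //; apply/asboolP.
(* At t = pi / 2 the number exp (2 i t) is - 1. *)
move=> b; exists (pi / 2), 1; split; first exact: normr1.
apply/(transfer_half_turnP N0 D_div sigma_pm1 kE) => j.
rewrite (mulrC 2) divfK ?pnatr_eq0 // expi_pi exprzN1 odd_half_eigenvalue // signr_odd.
by rewrite -exprMn mulrNN mulr1 expr1n.
Qed.
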